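(* Let $\ell,r\ge1$ and $n\ge(2r+1)\ell$. Then $$q^{r^2\ell}\cdot\frac{[n-\ell]_q}{[r]_q}\begin{bmatrix} n-\ell-2r\ell+r-1\\ r-1\end{bmatrix}_q=\sum_{T[n]\in\mathsf T(n,\ell,r)}q^{\mathrm{maj}_\ell(T[n])}.$$
   Context: For a tableau $T$ with distinct positive entries, $T[n]$ is obtained by placing above $T$ a top row consisting of all elements of $\{1,\dots,n\}$ not in $T$, in increasing order. $\mathsf T(n,\ell,r)$: the set of standard Young tableaux $T[n]$ with two rows (so $T$ is a single row) such that the entries of $T$ can be partitioned into $r$ runs, each of exactly $\ell$ numbers, where a run is either a set $\{a,a+1,\dots,a+\ell-1\}$ of consecutive integers (with starting number $a$), or a wraparound run $\{k+1,k+2,\dots,2k\}\cup\{n-\ell+k+1,\dots,n\}$ for some $1\le k\le\ell-1$ (with starting number $n-\ell+k+1$); and such that, ordering the runs by their starting numbers $s_1<\dots<s_r$, for each $j$ (indices mod $r$, so $s_{r+1}=s_1$) the residue of $s_{j+1}-s_j$ modulo $n-\ell$, taken in $\{1,\dots,n-\ell\}$, is at least $2\ell$. For a two-row standard Young tableau $T[n]$, the $\ell$-major index $\mathrm{maj}_\ell(T[n])$ is the sum of all $k$ with $k\ge\ell$ such that $k$ is in the top row and $k+1$ is in the second row. (For $\ell=1$ this is the usual major index.) $[m]_q=1+q+\dots+q^{m-1}$, $\begin{bmatrix} m\\ k\end{bmatrix}_q=\frac{[m]_q\cdots[m-k+1]_q}{[k]_q\cdots[1]_q}$. *)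

(* Defs.v *)
From HB Require Import structures.
From mathcomp Require Import all_boot all_order all_algebra.
From mathcomp Require Import fraction.
From Stdlib Require ClassicalDescription.
Unset Printing Implicit Defensive.
Import Order.TTheory GRing.Theory Num.Theory.

Definition RF := {fraction {poly int}}.
Definition qv : RF := tofrac ('X : {poly int}).

Local Open Scope ring_scope.
Definition qint (m : nat) : RF := \sum_(i < m) qv ^+ i.
Definition qbinom (m k : nat) : RF :=
  (\prod_(i < k) qint (m - i)) / (\prod_(i < k) qint (k - i)).
Local Close Scope ring_scope.

(* A set S : {set 'I_n.+1} encodes the second row T (entries in {1..n}). *)
Definition inS {n} (S : {set 'I_n.+1}) (k : nat) : bool :=
  [exists i in S, (i : nat) == k].

Definition top_row {n} (S : {set 'I_n.+1}) : seq nat := [seq k <- iota 1 n | ~~ inS S k].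
Definition bot_row {n} (S : {set 'I_n.+1}) : seq nat := [seq k <- iota 1 n | inS S k].

Definition two_row_SYT {n} (S : {set 'I_n.+1}) : bool :=
  [&& ord0 \notin S,
      size (bot_row S) <= size (top_row S),
      0 < size (bot_row S) &
      [forall j : 'I_n.+1, (j < size (bot_row S)) ==>
          (nth 0 (top_row S) j < nth 0 (bot_row S) j)]].

Inductive run := Consec of nat | Wrap of nat.

Definition run_valid (n l : nat) (x : run) : bool :=
  match x with
  | Consec a => (1 <= a) && (a + l - 1 <= n)
  | Wrap k => (1 <= k) && (k <= l - 1)
  end.

Definition in_run (n l : nat) (x : run) (m : nat) : bool :=
  match x with
  | Consec a => (a <= m) && (m <= a + l - 1)
  | Wrap k => ((k + 1 <= m) && (m <= 2 * k)) || ((n - l + k + 1 <= m) && (m <= n))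
  end.

Definition run_start (n l : nat) (x : run) : nat :=
  match x with
  | Consec a => a
  | Wrap k => n - l + k + 1
  end.

Local Open Scope ring_scope.
Definition resid1 (m : nat) (d : int) : int :=
  let t := (d %% m%:Z)%Z in if t == 0 then m%:Z else t.
Local Close Scope ring_scope.

Definition good_runs (n l r : nat) (S : {set 'I_n.+1}) (rs : seq run) : Prop :=
  [/\ size rs = r /\ all (run_valid n l) rs,
      sorted ltn (map (run_start n l) rs),
      (forall i j, i < r -> j < r -> i != j -> forall m,
          ~~ (in_run n l (nth (Consec 0) rs i) m && in_run n l (nth (Consec 0) rs j) m)),
      (forall m, inS S m = has (fun x => in_run n l x m) rs) &
      (forall j, j < r ->
         ((2 * l)%:Z <= resid1 (n - l)
            ((run_start n l (nth (Consec 0) rs ((j + 1) %% r)))%:Z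
             - (run_start n l (nth (Consec 0) rs j))%:Z))%R)].

Definition pbool (P : Prop) : bool :=
  if ClassicalDescription.excluded_middle_informative P then true else false.

Definition in_T {n : nat} (l r : nat) (S : {set 'I_n.+1}) : Prop :=
  two_row_SYT S /\ exists rs : seq run, good_runs n l r S rs.

Definition maj_l {n : nat} (l : nat) (S : {set 'I_n.+1}) : nat :=
  \sum_(1 <= k < n | (l <= k) && ~~ inS S k && inS S k.+1) k.

(* Main.v *)
Require Import Defs.
From HB Require Import structures.
From mathcomp Require Import all_boot all_order all_algebra.
From mathcomp Require Import fraction.
From mathcomp Require Import zify.
Import Order.TTheory GRing.Theory Num.Theory.

(** Put N = n - l and M = N - 2lr.  The ballot condition forces every run to
    start at some t + 1 with l <= t < n, and these t form a complete system of
    residues modulo N: the values t <= N are the starts of consecutive runs, the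
    values t > N those of wraparound runs.  The numbers t_1 < ... < t_r are
    exactly the descents counted by maj_l, and conversely every choice of them
    with cyclic gaps at least 2l modulo N gives a tableau, since shifting bottom
    entries down matches them with smaller top entries.  So the right-hand side
    is the sum of q^(t_1 + ... + t_r) over these sequences.

    If t_1 < 3l, the constraint is t_r <= t_1 + N - 2l; if t_1 >= 3l, it is
    t_r < n.  Subtracting 2l(i - 1) from t_i turns both sums into sums over
    multisets, so up to a common power of q they add up to
    [2lr]/[r] qbinom(M+r-1, r-1) + q^(2lr) qbinom(M+r-1, r), and
    qbinom(M+r-1, r) = [M]/[r] qbinom(M+r-1, r-1). *)

(** * q-integers and Gaussian binomials as rational functions *)

Section QIntegers.
Local Open Scope ring_scope.

Lemma qint0 : qint 0 = 0. Proof. by rewrite /qint big_ord0. Qed.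

(** As a polynomial it takes the value [m + 1] at [q = 1]. *)
Lemma qint_neq0 (m : nat) : qint m.+1 != 0.
Proof.
have -> : qint m.+1 = tofrac (\sum_(i < m.+1) 'X^i : {poly int}).
  by rewrite /qint /qv rmorph_sum; apply: eq_bigr => i _; rewrite rmorphXn.
rewrite tofrac_eq0; apply/eqP => /(congr1 (fun p : {poly int} => p.[1])).
rewrite horner_sum horner0.
under eq_bigr => i _ do rewrite hornerXn expr1n.
by rewrite sumr_const card_ord => /eqP; rewrite pnatr_eq0.
Qed.

Lemma qintD (m k : nat) : qint (m + k) = qint m + qv ^+ m * qint k.
Proof.
rewrite /qint big_split_ord /=; congr (_ + _).
by rewrite mulr_sumr; apply: eq_bigr => i _; rewrite exprD.
Qed.

Lemma qint_mul (m k : nat) :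
  qint (m * k) = qint k * \sum_(i < m) qv ^+ (k * i).
Proof.
elim: m => [|m IHm]; first by rewrite mul0n qint0 big_ord0 mulr0.
by rewrite mulSnr qintD IHm big_ord_recr /= mulrDr (mulnC m) (mulrC (qint k) (_ ^+ _)).
Qed.

Lemma qbinom0 (m : nat) : qbinom m 0 = 1.
Proof. by rewrite /qbinom !big_ord0 divr1. Qed.

Lemma qbinom_small (m k : nat) : (m < k)%N -> qbinom m k = 0.
Proof.
move=> lt_mk; rewrite /qbinom (bigD1 (Ordinal lt_mk)) //= subnn qint0.
by rewrite mul0r mul0r.
Qed.

Lemma qbinom_diag (m k : nat) :
  qbinom m.+1 k.+1 = qint m.+1 / qint k.+1 * qbinom m k.
Proof.
rewrite /qbinom !big_ord_recl !subn0.
under eq_bigr => i _ do rewrite subSS.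
under [in X in _ / X]eq_bigr => i _ do rewrite subSS.
by rewrite mulf_div.
Qed.

Lemma qbinom_lower (m k : nat) :
  qbinom m k.+1 = qint (m - k) / qint k.+1 * qbinom m k.
Proof.
rewrite /qbinom big_ord_recr big_ord_recl /= subn0.
under [in X in _ / X]eq_bigr => i _ do rewrite subSS.
by rewrite mulf_div (mulrC (qint (m - k))).
Qed.

(** All terms are multiples of [qbinom m k], and what remains is [m+1] = [k+1] + q^(k+1) [m-k]. *)
Lemma qbinom_pascal (m k : nat) : (k <= m)%N ->
  qbinom m.+1 k.+1 = qbinom m k + qv ^+ k.+1 * qbinom m k.+1.
Proof.
move=> le_km; rewrite qbinom_diag qbinom_lower.
have -> : m.+1 = (k.+1 + (m - k))%N by lia.
by rewrite qintD !mulrDl divff ?qint_neq0 // mul1r !mulrA.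
Qed.

End QIntegers.

(** * Generating functions of gapped sequences *)

Lemma mem_allpairs_cons (T : eqType) (e : seq T) (F : T -> seq (seq T)) s :
  (s \in [seq a :: s' | a <- e, s' <- F a]) =
  if s is a :: s' then (a \in e) && (s' \in F a) else false.
Proof.
apply/allpairsPdep/idP => [[x [y [ix iy ->]]]|]; first by rewrite ix.
by case: s => // a s /andP[ia is_]; exists a, s.
Qed.

Section GappedSequences.
Variable g : nat.

Definition gap : rel nat := fun x y => x + g <= y.

(* The sequences t_0, ..., t_(r-1) with t_(i+1) >= t_i + g such that the
   reduced sequence t_i - g i takes its values in [lo, lo + m). *)
Fixpoint gapped (r lo m : nat) : seq (seq nat) :=
  if r is r'.+1 then
    [seq a :: s | a <- iota lo m, s <- gapped r' (a + g) (lo + m - a)]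
  else [:: [::]].

Lemma gap_path_last (a : nat) (s : seq nat) :
  path gap a s -> a + g * size s <= last a s.
Proof.
elim: s a => [|b s IHs] a /=; first by lia.
by case/andP; rewrite {1}/gap => ab /IHs; lia.
Qed.

(** Each window ends [g] later than the one before, and by [gap_path_last] the bound on the last
    entry implies the bounds on all earlier ones. *)
Lemma mem_gapped (r lo m : nat) (s : seq nat) :
  (s \in gapped r lo m) =
  (size s == r) && (if s is a :: s' then
    [&& lo <= a, path gap a s' & last a s' < lo + m + g * r.-1] else true).
Proof.
elim: r lo m s => [|r IHr] lo m [|a s] //=; rewrite mem_allpairs_cons //.
rewrite mem_iota IHr eqSS; case: s => [|b s] /=.
  by case: r {IHr} => [|r] /=; lia.
case: (altP (_ =P r)) => [szr|]; last by rewrite andbF.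
rewrite !andTb /gap.
case: (boolP (path _ b s)) => [pbs|]; last by rewrite /= !(andbF, andFb).
have := gap_path_last _ _ pbs.
by rewrite -szr /= mulnS; move: (g * size s) => x; lia.
Qed.

Lemma gapped_uniq (r lo m : nat) : uniq (gapped r lo m).
Proof.
elim: r lo m => [|r IHr] lo m //=.
apply: allpairs_uniq_dep => [|a _|]; [exact: iota_uniq|exact: IHr|].
by move=> [a s] [b t] _ _ /= [-> ->].
Qed.

Definition gapped_gf (r lo m : nat) : RF :=
  (\sum_(s <- gapped r lo m) qv ^+ sumn s)%R.

Lemma gapped_gf_allpairs (e : seq nat) (r : nat) (h : nat -> nat) :
  (\sum_(s <- [seq a :: s | a <- e, s <- gapped r (a + g) (h a)]) qv ^+ sumn s
   = \sum_(a <- e) qv ^+ a * gapped_gf r (a + g) (h a))%R.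
Proof.
rewrite big_allpairs_dep; apply: eq_bigr => a _; rewrite mulr_sumr.
by apply: eq_bigr => s _; rewrite exprD.
Qed.

Lemma gapped_gfS (r lo m : nat) :
  (gapped_gf r.+1 lo m =
   \sum_(a <- iota lo m) qv ^+ a * gapped_gf r (a + g) (lo + m - a))%R.
Proof. exact: gapped_gf_allpairs. Qed.

(* Splitting according to whether the smallest entry is [lo]. *)
Lemma gapped_gf_rec (r lo m : nat) :
  (gapped_gf r.+1 lo m.+1 =
   qv ^+ lo * gapped_gf r (lo + g) m.+1 + gapped_gf r.+1 lo.+1 m)%R.
Proof.
rewrite !gapped_gfS /= big_cons addSn addnS.
by have -> : (lo + m).+1 - lo = m.+1 by lia.
Qed.

(** The reduced sequences are the multisets of size [r] from [m] consecutive values, and the gaps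
    contribute [g * 'C(r, 2)] to the exponent. Under induction, [gapped_gf_rec] becomes the Pascal
    rule. *)
Lemma gapped_gfE (r lo m : nat) :
  (gapped_gf r lo m =
   qv ^+ (r * lo + g * 'C(r, 2)) * qbinom (m + r - 1) r)%R.
Proof.
elim: r lo m => [|r IHr] lo m.
  by rewrite /gapped_gf big_seq1 bin0n muln0 qbinom0 mul1r.
elim: m lo => [|m IHm] lo.
  by rewrite qbinom_small ?mulr0 /gapped_gf ?big_nil //; lia.
rewrite gapped_gf_rec IHr IHm binS bin1.
have -> : m.+1 + r.+1 - 1 = (m + r).+1 by lia.
have -> : m.+1 + r - 1 = m + r by lia.
have -> : m + r.+1 - 1 = m + r by lia.
rewrite qbinom_pascal ?leq_addl // mulrDr mulrA -!exprD.
rewrite mulrA -exprD; congr (_ ^+ _ * _ + _ ^+ _ * _)%R; lia.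
Qed.

End GappedSequences.

(** * Sequences with cyclic gaps *)

(* The sequences t_1 < ... < t_r in [l, n) whose cyclic gaps modulo n - l are
   at least 2 l, split according to whether t_1 < 3 l; M = n - l - 2 l r. *)
Definition cyclic_seqs (l r M : nat) : seq (seq nat) :=
  [seq a :: s | a <- iota l (2 * l), s <- gapped (2 * l) r.-1 (a + 2 * l) M.+1]
  ++ gapped (2 * l) r (l + 2 * l) M.

Lemma cyclic_seqs_gf (l r M : nat) : 1 <= r ->
  (\sum_(s <- cyclic_seqs l r M) qv ^+ sumn s =
   qv ^+ (r ^ 2 * l) * (qint (M + 2 * l * r) / qint r)
     * qbinom (M + r - 1) (r - 1))%R.
Proof.
case: r => // r _; rewrite /cyclic_seqs big_cat gapped_gf_allpairs /=.
rewrite -[X in (_ + X)%R]/(gapped_gf (2 * l) r.+1 (l + 2 * l) M) gapped_gfE.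
have -> : M + r.+1 - 1 = M + r by lia.
rewrite subn1 /= qbinom_lower addnK.
have -> : iota l (2 * l) = map (addn l) (iota 0 (2 * l)).
  by rewrite -iotaDl addn0.
(* Turns the binomial in the exponents into the square [r.+1 ^ 2 * l]. *)
have C2 : 2 * l * 'C(r, 2) + l * r = l * (r * r).
  have : r * r.-1 = 'C(r, 2) * 2.
    by rewrite -[X in _ = _ * X]/(2`!) bin_ffact ffactnS ffactn1.
  by case: (r) => [|k] /= E; nia.
rewrite big_map -{1}[2 * l]subn0 big_mkord.
under eq_bigr => b _.
  rewrite gapped_gfE (_ : M.+1 + r - 1 = M + r); last by lia.
  rewrite mulrA -exprD (_ : (_ + _)%N = r.+1 ^ 2 * l + r.+1 * b); last by nia.
  rewrite exprD mulrAC; over.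
(* By [qint_mul], the sum of q^((r+1) b) over [b < 2 * l] is [2l(r+1)]/[r+1]; [qintD] splits the
   target to match the two families. *)
rewrite -mulr_sumr (addnC M (_ * _)) qintD qint_mul binS bin1.
rewrite (_ : r.+1 * _ + _ = r.+1 ^ 2 * l + 2 * l * r.+1); last by nia.
rewrite exprD (mulrC (qint r.+1)) (mulrDl (_ * qint r.+1)%R) mulfK ?qint_neq0 //.
by move: (qbinom _ _) => B; rewrite mulrDr mulrDl !mulrA (mulrAC _ B).
Qed.

(** For [N = n - l] the bound [N + l] is [n]; the last conjunct is the gap from the last entry round
    to the first modulo [N]. *)
Definition cyclic_gaps (l r N : nat) (s : seq nat) : bool :=
  [&& size s == r, sorted (gap (2 * l)) s, l <= head 0 s,
      last 0 s < N + l & last 0 s + 2 * l <= head 0 s + N].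

Lemma mem_cyclic_seqs (l r M : nat) (s : seq nat) : 1 <= l -> 1 <= r ->
  (s \in cyclic_seqs l r M) =
  cyclic_gaps l r (M + 2 * l * r) s.
Proof.
rewrite /cyclic_gaps.
case: r => // r l0 _; rewrite mem_cat mem_allpairs_cons mem_gapped.
case: s => [|a s] //=.
rewrite mem_iota mem_gapped eqSS.
case: (altP (_ =P r)) => [szr|]; last by rewrite !andbF.
rewrite !andTb mulnS.
case: (boolP (path _ a s)) => [pas|npas].
  have := gap_path_last _ _ _ pas.
  case: s szr pas => [|b s] /= szr; first by rewrite -szr; lia.
  case/andP => ab ->; move: ab; rewrite /gap -szr mulnS /=.
  by move: (2 * l * size s) => x; lia.
case: s szr npas => [|b s] //= szr.
by rewrite negb_and => /orP[|] /negPf; rewrite /gap => ->; rewrite ?andbF //; lia.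
Qed.

Lemma cyclic_seqs_uniq (l r M : nat) : uniq (cyclic_seqs l r M).
Proof.
rewrite cat_uniq gapped_uniq andbT; apply/andP; split.
  apply: allpairs_uniq_dep => [|a _|]; [exact: iota_uniq|exact: gapped_uniq|].
  by move=> [a s] [b t] _ _ /= [-> ->].
apply/hasPn => s; rewrite mem_gapped mem_allpairs_cons.
by case: s => [|a s] //=; rewrite mem_iota; lia.
Qed.

(** * Counting in initial segments and the ballot condition *)

Section Counting.
Variable P : pred nat.

Lemma count_iotaS (x : nat) : 0 < x ->
  count P (iota 1 x) = count P (iota 1 x.-1) + P x.
Proof. by case: x => // x _; rewrite -[in LHS](addn1 x) iotaD count_cat /= addn0 add1n. Qed.

Lemma leq_count_iota (x y : nat) : x <= y ->
  count P (iota 1 x) <= count P (iota 1 y).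
Proof. by move=> /subnKC <-; rewrite iotaD count_cat leq_addr. Qed.

Lemma index_filter_iota (n x : nat) : 0 < x <= n -> P x ->
  index x (filter P (iota 1 n)) = count P (iota 1 x.-1).
Proof.
move=> xn Px; have -> : n = x.-1 + (n - x).+1 by lia.
rewrite iotaD filter_cat index_cat mem_filter mem_iota.
have -> : (x < 1 + x.-1) = false by lia.
have -> : 1 + x.-1 = x by lia.
by rewrite !andbF /= Px /= eqxx addn0 size_filter.
Qed.

Lemma count_iota_nth (n j : nat) (s := filter P (iota 1 n)) (x := nth 0 s j) :
  j < size s -> [/\ 0 < x <= n, P x & count P (iota 1 x.-1) = j].
Proof.
move=> js; have := mem_nth 0 js; rewrite -/x mem_filter mem_iota.
case/andP=> Px xn; have xn' : 0 < x <= n by lia.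
split=> //; rewrite -(index_filter_iota n) // index_uniq //.
exact/filter_uniq/iota_uniq.
Qed.

(** Since [f] decreases entries, it injects the part of [P] in each initial segment into the
    complement within the same segment. *)
Lemma leq_count_predC_iota (n : nat) (f : nat -> nat) :
  (forall m, 0 < m <= n -> P m -> 0 < f m < m /\ ~~ P (f m)) ->
  (forall m m', 0 < m <= n -> 0 < m' <= n -> P m -> P m' -> f m = f m' -> m = m') ->
  forall x, x <= n -> count P (iota 1 x) <= count (predC P) (iota 1 x).
Proof.
move=> fP f_inj x xn; rewrite -!size_filter -(size_map f).
apply: uniq_leq_size.
  rewrite map_inj_in_uniq ?filter_uniq ?iota_uniq // => m m'.
  by rewrite !mem_filter !mem_iota => /andP[? ?] /andP[? ?]; apply: f_inj => //; lia.
move=> _ /mapP[m mP ->]; move: mP; rewrite !mem_filter !mem_iota /=.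
case/andP=> Pm mx; have [|] := fP m _ Pm; first by lia.
by move=> fm ->; lia.
Qed.

End Counting.

Section Ballot.
Context {n : nat}.
Implicit Type S : {set 'I_n.+1}.

Lemma inSE S (i : 'I_n.+1) : inS S i = (i \in S).
Proof.
apply/existsP/idP => [[j /andP[jS /eqP/val_inj <-]] //|iS].
by exists i; rewrite iS eqxx.
Qed.

Lemma inS_inj S1 S2 : inS S1 =1 inS S2 -> S1 = S2.
Proof. by move=> E; apply/setP => i; rewrite -!inSE E. Qed.

(** If [x] has index [j] in the bottom row, the top entry of index [j] is smaller, so below [x] lie
    [j] bottom entries and at least [j + 1] top ones. *)
Lemma two_row_SYT_ballot S : two_row_SYT S ->
  forall x, 0 < x <= n -> inS S x ->
  count (inS S) (iota 1 x.-1) < count (predC (inS S)) (iota 1 x.-1).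
Proof.
case/and4P=> _ le_bt _ /forallP SYT x xn Sx.
have xb : x \in bot_row S by rewrite mem_filter Sx mem_iota; lia.
set j := index x (bot_row S).
have jb : j < size (bot_row S) by rewrite index_mem.
have szb : size (bot_row S) <= n.
  by rewrite size_filter -[X in _ <= X](size_iota 1) count_size.
have jn : j < n.+1 by lia.
have := SYT (Ordinal jn); rewrite /= jb /= nth_index //.
have [yn Ty cy] := count_iota_nth (predC (inS S)) n j (leq_trans jb le_bt).
rewrite -/(top_row S) in yn Ty cy; set y := nth _ _ _ in yn Ty cy *.
move=> yx; have <- : j = count (inS S) (iota 1 x.-1) by exact: index_filter_iota.
have yx1 : y <= x.-1 by lia.
apply: leq_trans (leq_count_iota _ _ _ yx1).
by rewrite count_iotaS ?Ty ?cy; lia.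
Qed.

Lemma ballot_two_row_SYT S :
  ord0 \notin S -> (exists2 m, 0 < m <= n & inS S m) ->
  (forall x, x <= n ->
     count (inS S) (iota 1 x) <= count (predC (inS S)) (iota 1 x)) ->
  two_row_SYT S.
Proof.
move=> S0 [m mn Sm] ballot; apply/and4P; split=> //.
- by rewrite !size_filter ballot.
- by rewrite size_filter -has_count; apply/hasP; exists m; rewrite ?mem_iota; lia.
apply/forallP => j; apply/implyP => jb.
have [xn Sx cx] := count_iota_nth (inS S) n j jb.
rewrite -/(bot_row S) in xn Sx cx; set x := nth _ _ _ in xn Sx cx *.
have jt : j < size (top_row S).
  by apply: leq_trans jb _; rewrite !size_filter ballot.
have [yn Ty cy] := count_iota_nth (predC (inS S)) n j jt.
rewrite -/(top_row S) in yn Ty cy; set y := nth _ _ _ in yn Ty cy *.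
(* If [x <= y], then up to [x] there are [j + 1] bottom entries but at most [j] top ones, against
   the ballot condition. *)
rewrite ltnNge; apply/negP => xy.
have xy1 : x.-1 <= y.-1 by lia.
have := leq_count_iota (predC (inS S)) _ _ xy1; rewrite cy.
have /andP[x0 xln] := xn.
have := ballot x xln.
by rewrite (count_iotaS (inS S)) // (count_iotaS (predC _) x) // cx /= Sx; lia.
Qed.

(* By the ballot condition, a block of l consecutive bottom entries is
   preceded by at least l top entries. *)
Lemma two_row_SYT_block S (a l : nat) : two_row_SYT S -> 1 <= l ->
  0 < a -> a + l - 1 <= n -> (forall m, a <= m <= a + l - 1 -> inS S m) -> l < a.
Proof.
move=> SYT l0 a0 aln blk; set x := a + l - 1.
have xn : 0 < x <= n by lia.
have Sx : inS S x by apply: blk; lia.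
have := two_row_SYT_ballot S SYT x xn Sx.
have -> : x.-1 = a.-1 + l.-1 by lia.
rewrite iotaD !count_cat (_ : 1 + a.-1 = a); last by lia.
have /eqP -> : count (inS S) (iota a l.-1) == size (iota a l.-1).
  by rewrite -all_count; apply/allP => m; rewrite mem_iota => ma; apply: blk; lia.
have /eqP -> : count (predC (inS S)) (iota a l.-1) == 0.
  rewrite -leqn0 leqNgt -has_count; apply/hasPn => m; rewrite mem_iota /= => ma.
  by rewrite blk //; lia.
have := count_size (predC (inS S)) (iota 1 a.-1); rewrite !size_iota; lia.
Qed.

End Ballot.

(** * Unions of separated runs *)

(** Position-free form of the cyclic gaps: it compares any two entries, on both arcs between
    them. *)
Definition separated (l n : nat) (s : seq nat) : Prop :=
  (forall t, t \in s -> l <= t < n) /\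
  (forall t t', t \in s -> t' \in s -> t < t' ->
     t + 2 * l <= t' /\ t' + 2 * l <= t + (n - l)).

Lemma gap_trans (g : nat) : transitive (gap g).
Proof. by move=> y x z; rewrite /gap; lia. Qed.

Lemma cyclic_gaps_separated (l r n : nat) (s : seq nat) :
  1 <= l -> l <= n -> cyclic_gaps l r (n - l) s -> separated l n s.
Proof.
move=> l0 ln /and5P[_ srt hd lst wrap].
have nth_gap i j : i < j < size s -> nth 0 s i + 2 * l <= nth 0 s j.
  by move=> ij; apply: (sorted_ltn_nth (gap_trans _) 0 srt); rewrite ?inE; lia.
have hdE : head 0 s = nth 0 s 0 by rewrite nth0.
have lstE : last 0 s = nth 0 s (size s).-1 by rewrite nth_last.
have bnd i : i < size s -> head 0 s <= nth 0 s i <= last 0 s.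
  move=> i_s; have H1 := nth_gap 0 i; have H2 := nth_gap i (size s).-1.
  apply/andP; split.
    by rewrite hdE; case: (posnP i) => [->//|i0]; have := H1; lia.
  rewrite lstE; case: (eqVneq i (size s).-1) => [->//|i0].
  by have := H2; lia.
split=> [t ts|t t' ts ts' tt'].
  have := bnd (index t s); rewrite index_mem nth_index //; lia.
have := bnd (index t s); have := bnd (index t' s).
have := nth_gap (index t s) (index t' s); have := nth_gap (index t' s) (index t s).
rewrite !index_mem !nth_index // ts ts'.
have neq : index t s <> index t' s.
  by move=> E; move: tt'; rewrite -(nth_index 0 ts) E nth_index // ltnn.
by lia.
Qed.

(* [t] is the starting number minus one, as this is the descent that the run
   contributes to the l-major index. *)
Definition run_of (n l t : nat) : run :=
  if t <= n - l then Consec t.+1 else Defs.Wrap (t - (n - l)).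

(** One formula for both kinds: if [t <= n - l], the truncated difference is 0 and the second
    interval is empty; otherwise the minimum is [n]. *)
Lemma in_run_of (n l t m : nat) : 1 <= l -> l <= t < n ->
  in_run n l (run_of n l t) m =
  (t < m <= minn (t + l) n) || (t - (n - l) < m <= 2 * (t - (n - l))).
Proof.
by move=> l0 tn; rewrite /run_of; case: ifP => tN /=; lia.
Qed.

Definition in_runs (n l : nat) (s : seq nat) (m : nat) : bool :=
  has (fun t => in_run n l (run_of n l t) m) s.

Section Separated.
Variables (l n : nat) (s : seq nat).
Hypotheses (l0 : 1 <= l) (ln : 3 * l <= n) (sep : separated l n s).

Let bnd t : t \in s -> l <= t < n. Proof. by case: sep => H _; apply: H. Qed.

Let trich t t' : t \in s -> t' \in s ->
  t = t' \/ (t + 2 * l <= t' /\ t' + 2 * l <= t + (n - l)) \/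
  (t' + 2 * l <= t /\ t + 2 * l <= t' + (n - l)).
Proof.
case: sep => _ H ts ts'; case: (ltngtP t t') => tt'; last by left.
  by right; left; apply: H.
by right; right; apply: H.
Qed.

Lemma in_runsP (m : nat) :
  reflect (exists2 t, t \in s & (t < m <= minn (t + l) n) ||
             (t - (n - l) < m <= 2 * (t - (n - l))))
          (in_runs n l s m).
Proof.
apply: (iffP hasP) => -[t ts tm]; exists t => //; move: tm;
  by rewrite in_run_of ?bnd.
Qed.

Lemma in_runs_bound (m : nat) : in_runs n l s m -> 0 < m <= n.
Proof. by case/in_runsP => t /bnd; lia. Qed.

(** The descent before the initial segment of a wraparound run is below [l], hence not counted. The
    gaps keep every [t] in [s] out of all runs. *)
Lemma descent_in_runs (k : nat) :
  (l <= k) && ~~ in_runs n l s k && in_runs n l s k.+1 = (k \in s).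
Proof.
apply/idP/idP.
  case/andP=> /andP[lk /in_runsP nk] /in_runsP[t ts tk].
  suff -> : k = t by [].
  apply/eqP/negP => /negP /eqP kt; apply: nk; exists t => //.
  by have := bnd _ ts; lia.
move=> ks; have kn := bnd _ ks; apply/andP; split; last first.
  by apply/in_runsP; exists k => //; lia.
apply/andP; split; first by lia.
apply/in_runsP => -[t ts tk].
by have := bnd _ ts; have := trich _ _ ks ts; lia.
Qed.

Lemma in_runs_disjoint (t t' m : nat) : t \in s -> t' \in s -> t <> t' ->
  ~~ (in_run n l (run_of n l t) m && in_run n l (run_of n l t') m).
Proof.
move=> ts ts' tt'; rewrite !in_run_of ?bnd //.
by have := bnd _ ts; have := bnd _ ts'; have := trich _ _ ts ts'; lia.
Qed.

(* Shifting each run down by [l], and the initial segment of a wraparound run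
   down by its length [k], matches bottom entries with smaller top entries. *)
Lemma in_runs_ballot (x : nat) : x <= n ->
  count (in_runs n l s) (iota 1 x) <= count (predC (in_runs n l s)) (iota 1 x).
Proof.
(* At most one run wraps around, as two such starts would be less than [l] apart; [k = 0] if there
   is none. *)
have [k [kl kw]] : exists k, k < l /\
    (forall t, t \in s ->
      t <= n - l /\ (0 < k -> k + 2 * l <= t) \/ t = n - l + k /\ 0 < k).
  case: (boolP (has (fun w => n - l < w) s)) => [/hasP[w ws wn]|/hasPn now].
    exists (w - (n - l)); have := bnd _ ws; split; first by lia.
    by move=> t ts; have := bnd _ ts; have := trich _ _ ts ws; lia.
  by exists 0; split=> // t ts; have := now _ ts; lia.
pose f m := if m <= 2 * k then m - k else m - l.
(* Hence the two branches of [f] have disjoint images: one stays within [k], the other exceeds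
   [k]. *)
have fk m : in_runs n l s m -> if m <= 2 * k then k < m else k + l < m.
  by case/in_runsP=> t ts; have := bnd _ ts; have := kw _ ts; case: ifP; lia.
apply: (leq_count_predC_iota _ n f) => [m mn Pm|m m' _ _ /fk Pm /fk Pm' E].
  have Pk := fk _ Pm; split; first by rewrite /f; case: ifP Pk; lia.
  apply/in_runsP => -[t' ts']; case/in_runsP: Pm => t ts.
  have := bnd _ ts; have := bnd _ ts'; have := kw _ ts; have := kw _ ts'.
  have := trich _ _ ts ts'; move: Pk; rewrite /f; case: ifP; lia.
by move: E Pm Pm'; rewrite /f; case: ifP; case: ifP; lia.
Qed.

End Separated.

(** * The bijection between tableaux and cyclic sequences *)

Lemma resid1_sub (N x y : nat) : x < y < x + N ->
  resid1 N (y%:Z - x%:Z)%R = Posz (y - x).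
Proof.
move=> xy; rewrite /resid1 modz_small; last by lia.
by case: ifP; lia.
Qed.

(** The case [x = y], with residue [N] instead of 0, arises for a single run. *)
Lemma resid1_wrap (N x y : nat) : y <= x < y + N ->
  resid1 N (y%:Z - x%:Z)%R = Posz (y + N - x).
Proof.
move=> xy; rewrite /resid1; case: (eqVneq x y) => [->|neq].
  by rewrite subrr mod0z /=; lia.
rewrite -(modzDr _ N) modz_small; last by lia.
by case: ifP; lia.
Qed.

Lemma pboolP (P : Prop) : reflect P (pbool P).
Proof.
by rewrite /pbool; case: ClassicalDescription.excluded_middle_informative => H;
  constructor.
Qed.

Section Tableaux.
Variables (l r n : nat).
Hypotheses (l0 : 1 <= l) (r0 : 1 <= r) (ln : 3 * l <= n).
Implicit Type S : {set 'I_n.+1}.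

Lemma in_T_cyclic_gaps S : in_T l r S ->
  exists2 s, cyclic_gaps l r (n - l) s & inS S =1 in_runs n l s.
Proof.
case=> SYT [rs [[szr /(all_nthP (Consec 0)) val] srt _ SE gaps]].
rewrite szr in val; set x_ := nth (Consec 0) rs.
(* [two_row_SYT_block] puts the start of a consecutive run beyond [l]. Such starts are at most
   [n - l + 1] and wraparound starts exceed this, so the start determines the run. *)
have start j : j < r ->
    l < run_start n l (x_ j) <= n /\ run_of n l (run_start n l (x_ j)).-1 = x_ j.
  move=> jr; have := val j jr; rewrite -/(x_ j).
  case E: (x_ j) => [a|k] /= v; last first.
    by split; first lia; rewrite /run_of; case: ifP => H; [lia|congr Defs.Wrap; lia].
  have la : l < a.
    apply: (two_row_SYT_block S) => //; try lia.
    move=> m ma; rewrite SE; apply/(has_nthP (Consec 0)).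
    by exists j; rewrite ?szr // -/(x_ j) E.
  by split; first lia; rewrite /run_of; case: ifP => H; [congr Consec; lia|lia].
set st := map (run_start n l) rs in srt.
have stE j : j < r -> run_start n l (nth (Consec 0) rs j) = nth 0 st j.
  by move=> jr; rewrite (nth_map (Consec 0)) ?szr.
have bnd j : j < r -> l < nth 0 st j <= n.
  by move=> jr; rewrite -stE //; case: (start j).
have szst : size st = r by rewrite size_map.
exists (map predn st); last first.
  have rsE : rs = map (run_of n l) (map predn st).
    rewrite -!map_comp; apply: (eq_from_nth (x0 := Consec 0)); rewrite ?size_map //.
    move=> j; rewrite szr => jr; rewrite (nth_map (Consec 0)) ?szr //=.
    by case: (start j jr) => _ ->.
  by move=> m; rewrite SE [in LHS]rsE has_map.
have nthE j : j < r -> nth 0 (map predn st) j = (nth 0 st j).-1.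
  by move=> jr; rewrite (nth_map 0) ?szst.
have hdE : head 0 (map predn st) = (nth 0 st 0).-1 by rewrite -nth0 nthE.
have lstE : last 0 (map predn st) = (nth 0 st r.-1).-1.
  by rewrite -nth_last size_map szst nthE //; lia.
apply/and5P; split; rewrite ?size_map ?szr ?hdE ?lstE //.
- apply/(sortedP 0) => i; rewrite size_map szst => ir.
  have := gaps i (ltnW ir); rewrite modn_small ?addn1 // !stE //; last by lia.
  have := sortedP 0 srt i; rewrite szst => /(_ ir) lt_i.
  have := bnd i (ltnW ir); have := bnd _ ir.
  by move=> b1 b2; rewrite resid1_sub ?nthE /gap; try lia.
- by have := bnd 0 r0; lia.
- by have := bnd r.-1; lia.
have := gaps r.-1; have -> : r.-1 + 1 = r by lia.
rewrite modnn !stE //; last by lia.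
have := bnd 0 r0; have := bnd r.-1.
have : nth 0 st 0 <= nth 0 st r.-1.
  have [->|r1] := posnP r.-1; first by [].
  by apply/ltnW/(sorted_ltn_nth ltn_trans 0 srt); rewrite ?inE ?szst; lia.
move=> le0r /(_ ltac:(lia)) b1 b2 /(_ ltac:(lia)).
by rewrite resid1_wrap; lia.
Qed.

Lemma cyclic_gaps_in_T S (s : seq nat) :
  cyclic_gaps l r (n - l) s -> inS S =1 in_runs n l s -> in_T l r S.
Proof.
move=> cyc SE; have sep := cyclic_gaps_separated l r n s l0 ltac:(lia) cyc.
have [bnd sp] := sep.
case/and5P: cyc => /eqP szs srt hd lst wrap.
have hdE : head 0 s = nth 0 s 0 by rewrite nth0.
have lstE : last 0 s = nth 0 s r.-1 by rewrite -nth_last szs.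
split.
  apply: ballot_two_row_SYT.
  - rewrite -inSE SE; apply/negP => /(in_runs_bound _ _ _ l0 ln sep) /=; lia.
  - have hs : nth 0 s 0 \in s by rewrite mem_nth ?szs.
    exists (nth 0 s 0).+1; first by have := bnd _ hs; lia.
    rewrite SE; apply/(in_runsP _ _ _ l0 sep); exists (nth 0 s 0) => //.
    by have := bnd _ hs; lia.
  have CE : predC (inS S) =1 predC (in_runs n l s) by move=> m /=; rewrite SE.
  by move=> x xn; rewrite (eq_count SE) (eq_count CE) in_runs_ballot.
have runE t : t \in s -> run_start n l (run_of n l t) = t.+1.
  by move=> /bnd tn; rewrite /run_of; case: ifP => /=; lia.
have nthE j : j < r -> nth (Consec 0) (map (run_of n l) s) j = run_of n l (nth 0 s j).
  by move=> jr; rewrite (nth_map 0) ?szs.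
have uniq_s : uniq s.
  apply: (sorted_uniq ltn_trans ltnn); apply: sub_sorted srt => x y.
  by rewrite /gap; lia.
exists (map (run_of n l) s); split.
- split; first by rewrite size_map.
  rewrite all_map; apply/allP => t /bnd tn; rewrite /= /run_of.
  by case: ifP => /=; lia.
- have -> : map (run_start n l) (map (run_of n l) s) = map succn s.
    by rewrite -map_comp; apply/eq_in_map => t /runE.
  by rewrite sorted_map; apply: sub_sorted srt => x y; rewrite /gap /=; lia.
- move=> i j ir jr ij m; rewrite !nthE //.
  apply: (in_runs_disjoint _ _ s) => //; rewrite ?mem_nth ?szs //.
  by apply/eqP; rewrite nth_uniq ?szs.
- by move=> m; rewrite SE /in_runs has_map.
move=> j jr; have jr' : (j + 1) %% r < r by rewrite ltn_mod.
rewrite !nthE // !runE ?mem_nth ?szs //.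
have := bnd (nth 0 s j); have := bnd (nth 0 s ((j + 1) %% r)).
rewrite !mem_nth ?szs // => /(_ isT) b1 /(_ isT) b2.
have [lt_jr|] := ltnP (j + 1) r.
  rewrite modn_small // addn1 in b1 *; rewrite addn1 in lt_jr.
  have := sortedP 0 srt j; rewrite szs /gap => /(_ lt_jr) gj.
  by rewrite resid1_sub; lia.
(* Here [j] is the last index, so the gap closes the cycle. *)
move=> le_rj; have Er : r = j + 1 by lia.
move: b1; rewrite -Er modnn => b1.
have Ej : r.-1 = j by lia.
rewrite Ej in lstE.
have le0j : nth 0 s 0 <= nth 0 s j.
  have [->|j0] := posnP j; first by [].
  by have := sorted_ltn_nth (gap_trans _) 0 srt 0 j; rewrite !inE szs /gap; lia.
by rewrite resid1_wrap; lia.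
Qed.

Definition descents S : seq nat :=
  [seq k <- index_iota 1 n | (l <= k) && ~~ inS S k && inS S k.+1].

Lemma maj_descents S : maj_l l S = sumn (descents S).
Proof. by rewrite sumnE big_filter. Qed.

Lemma descents_in_runs S (s : seq nat) :
  cyclic_gaps l r (n - l) s -> inS S =1 in_runs n l s -> descents S = s.
Proof.
move=> cyc SE; have sep := cyclic_gaps_separated l r n s l0 ltac:(lia) cyc.
case/and5P: cyc => _ srt _ _ _.
apply: (irr_sorted_eq ltn_trans ltnn).
- by apply: sorted_filter; [exact: ltn_trans|exact: iota_ltn_sorted].
- by apply: sub_sorted srt => x y; rewrite /gap; lia.
move=> k; rewrite mem_filter mem_index_iota !SE descent_in_runs //.
by apply: andb_idr => /(proj1 sep); lia.
Qed.

(** The descents determine the runs and thus the bottom row, which gives injectivity; the union of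
    the runs of a cyclic sequence is its preimage. *)
Lemma perm_descents (M : nat) : n - l = M + 2 * l * r ->
  perm_eq [seq descents A | A <- enum [pred A : {set 'I_n.+1} | pbool (in_T l r A)]]
          (cyclic_seqs l r M).
Proof.
move=> NE; apply: uniq_perm (cyclic_seqs_uniq _ _ _) _.
  rewrite map_inj_in_uniq ?enum_uniq // => S1 S2.
  rewrite !mem_enum !inE => /pboolP/in_T_cyclic_gaps[s1 c1 E1].
  case/pboolP/in_T_cyclic_gaps => s2 c2 E2.
  rewrite (descents_in_runs S1 s1) // (descents_in_runs S2 s2) // => E12.
  by apply: inS_inj => m; rewrite E1 E2 E12.
move=> s; rewrite mem_cyclic_seqs // -NE; apply/mapP/idP.
  case=> S; rewrite mem_enum inE => /pboolP/in_T_cyclic_gaps[t ct Et] ->.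
  by rewrite (descents_in_runs S t).
move=> cs; pose S := [set i : 'I_n.+1 | in_runs n l s i].
have SE : inS S =1 in_runs n l s.
  move=> m; have [mn|nm] := ltnP m n.+1.
    by rewrite -[m]/(nat_of_ord (Ordinal mn)) inSE inE.
  transitivity false.
    by apply/existsP => -[i /andP[_ /eqP im]]; have := ltn_ord i; lia.
  apply/esym/negbTE/negP; have sep := cyclic_gaps_separated l r n s l0 ltac:(lia) cs.
  by move/(in_runs_bound _ _ _ l0 ln sep); lia.
exists S; last by rewrite (descents_in_runs S s).
by rewrite mem_enum inE; apply/pboolP; apply: cyclic_gaps_in_T cs SE.
Qed.

End Tableaux.

Theorem theorem4p6 (l r n : nat) :
  1 <= l -> 1 <= r -> (2 * r + 1) * l <= n ->
  (qv ^+ (r ^ 2 * l) * (qint (n - l) / qint r)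
     * qbinom (n - l - 2 * r * l + r - 1) (r - 1))%R
  = (\sum_(S : {set 'I_n.+1} | pbool (in_T l r S)) qv ^+ maj_l l S)%R.
Proof.
move=> l0 r0 ln; set M := n - l - 2 * r * l.
have NE : n - l = M + 2 * l * r by rewrite /M; nia.
have ln3 : 3 * l <= n by nia.
rewrite NE -cyclic_seqs_gf //.
rewrite -(perm_big _ (perm_descents l r n l0 r0 ln3 M NE)) /=.
rewrite big_map big_enum /=.
by apply: eq_bigr => S _; rewrite maj_descents.
Qed.
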